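(* Let $f:\mathbb{R}^+\to[0,1]$ be a smooth function such that $f$ and $g(x):=f(x)-f(x+1)$ are both strictly decreasing, both converge to $0$ as $x\to\infty$, and $g$ is smooth. Let $F= \{0\} \cup \{f(n)\}_{n\geq 1}\subset\mathbb{R}$, with $n$ ranging over the positive integers. Then for all $\theta \in (0,1)$ we have \[ \dim_\mathrm{A}^{\theta} F \ = \ \min\left\{\frac{\overline{\dim}_\mathrm{B}F}{1-\theta}, \ 1\right\}. \]
   Context: For a subset $E$ of a metric space and $r>0$, $N(E,r)$ denotes the minimal number of balls of radius $r$ required to cover $E$, and $B(x,R)$ is the ball of radius $R$ centred at $x$. For $\theta\in(0,1)$, the Assouad spectrum of $F$ at $\theta$ is \[ \dim_{\mathrm A}^{\theta} F = \inf\Big\{\alpha : \exists C>0,\ \exists \rho>0,\ \forall\, 0<R\leq\rho,\ \forall x\in F,\ N(B(x,R)\cap F,R^{1/\theta})\leq C \big(R/R^{1/\theta}\big)^{\alpha}\Big\}. \] The upper box dimension of a totally bounded set $F$ is $\overline{\dim}_{\mathrm B}F=\limsup_{R\to0}\frac{\log N(F,R)}{-\log R}$. *)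

(* Defs.v *)
From HB Require Import structures.
From mathcomp Require Import all_boot all_order all_algebra.
From mathcomp Require Import all_classical all_reals all_analysis.
Set Implicit Arguments.
Unset Strict Implicit.
Unset Printing Implicit Defensive.
Import Order.TTheory GRing.Theory Num.Theory.
Import numFieldNormedType.Exports.

Local Open Scope classical_set_scope.
Local Open Scope ring_scope.

(* Balls are open and their centres range over the whole ambient space.  The
   value is +oo when no finite family of balls of radius r covers E. *)
Definition covering_number (R : realType) (M : metricType R)
    (E : set M) (r : R) : \bar R :=
  ereal_inf [set (size s)%:R%:E | s in
    [set s : seq M | E `<=` \bigcup_(x in [set` s]) ball x r]].

(* The exponents range over all of R.  The infimum is taken in \bar R, hence is
   +oo (and not a junk real) if no exponent is admissible. *)
Definition assouad_spectrum (R : realType) (M : metricType R)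
    (F : set M) (theta : R) : \bar R :=
  ereal_inf [set alpha%:E | alpha in
    [set alpha : R | exists2 C : R, 0 < C & exists2 rho : R, 0 < rho &
      forall r : R, 0 < r <= rho -> forall x : M, F x ->
        (covering_number (ball x r `&` F) (r `^ theta^-1)
          <= (C * (r / r `^ theta^-1) `^ alpha)%:E)%E]].

Definition upper_box_dim (R : realType) (M : metricType R)
    (F : set M) : \bar R :=
  limf_esup (fun r : R => (lne (covering_number F r) / (- ln r)%:E)%E) 0^'+.

(* Only meaningful for open D: the derivatives are two-sided ones of the total
   function f. *)
Definition smooth_on (R : realType) (D : set R) (f : R -> R) : Prop :=
  forall (n : nat) (x : R), D x -> derivable (derive1n n f) x 1.

Definition strictly_decreasing_on (R : realType) (D : set R) (f : R -> R) :
  Prop := forall x y : R, D x -> D y -> x < y -> f y < f x.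

Definition gap (R : realType) (f : R -> R) (x : R) : R := f x - f (x + 1).

(* The library puts the metric space structure of the line on R^o, not on R. *)
Definition sequence_set (R : realType) (f : R -> R) : set R^o :=
  [set 0] `|` [set f n%:R | n in [set n : nat | (1 <= n)%N]].

(* Main.v *)
Require Import Defs.
From HB Require Import structures.
From mathcomp Require Import all_boot all_order all_algebra.
From mathcomp Require Import all_classical all_reals all_analysis.
From mathcomp Require Import ring lra.
Set Implicit Arguments.
Unset Strict Implicit.
Unset Printing Implicit Defensive.
Import Order.TTheory GRing.Theory Num.Theory.
Import numFieldNormedType.Exports.
Local Open Scope classical_set_scope.
Local Open Scope ring_scope.

(** Write kappa = 1 / theta > 1 and delta = r ^ kappa.

    The inequality <= has nothing to do with sequences.  Covering the whole of
    F instead of ball x r `&` F shows that d / (1 - theta) is an admissible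
    exponent whenever d exceeds the upper box dimension
    ([assouad_spectrum_le_box]); on the line, an interval of radius r needs
    only O(r / delta) balls, so that 1 is admissible too
    ([assouad_spectrum_le1]).

    For >=, let alpha < 1 be admissible.  Only the balls around the
    accumulation point 0 are needed: they give
    N (ball 0 r `&` F, delta) <= C r ^ (- b) for all small r, with
    b = (kappa - 1) alpha < kappa - 1.  Convexity of the sequence, that is
    monotonicity of its gaps, makes this information global.

    - Were the gap below some term a n >= r / 2 shorter than 2 delta, all later
      gaps would be too, F would be 2 delta-dense in [0, r / 2], and about
      r / delta = r ^ (1 - kappa) balls would be needed, which for small r
      exceeds C r ^ (- b).  Hence gaps at height r / 2 or above are at least
      2 delta ([gap_ge]).
    - Therefore the terms between r / 2 and r are separated, and there are at
      most C r ^ (- b) of them.  Summing this geometric progression over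
      dyadic scales, all the way up from r, bounds the number of terms above r
      by A r ^ (- b) ([index_le]).
    - Covering the terms above r = delta ^ theta one by one and the others by
      the local bound gives
      N (F, delta) <= (C + A) r ^ (- b) = (C + A) delta ^ (- (1 - theta) alpha)
      ([range0_cover]), so that the upper box dimension is at most
      (1 - theta) alpha ([upper_box_dim_range0_le]).

    The sum in the second step is geometric only if alpha > 0; as admissible
    exponents are nonnegative ([admissible_ge0]), it suffices to work with
    exponents slightly above alpha and to let them tend to alpha. *)

(** * Powers and extended reals *)

Lemma powR_small (R : realType) (e c : R) : 0 < e -> 0 < c ->
  exists2 rho : R, 0 < rho <= 1 & forall r, 0 < r <= rho -> r `^ e <= c.
Proof.
move=> e0 c0; exists (Num.min 1 (c `^ e^-1)).
  by rewrite lt_min ltr01 powR_gt0 // ge_min lexx.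
move=> r /andP[r0]; rewrite le_min => /andP[_ rc].
have -> : c = (c `^ e^-1) `^ e by rewrite -powRrM mulVf ?gt_eqF // powRr1 ?ltW.
by apply: ge0_ler_powR; rewrite ?nnegrE ?powR_ge0 // ltW.
Qed.

Lemma powR_ratio (R : realType) (r k a : R) : 0 < r ->
  (r / r `^ k) `^ a = r `^ (- ((k - 1) * a)).
Proof.
move=> r0; have -> : r / r `^ k = r `^ (1 - k).
  by rewrite powRB ?(gt_eqF r0) ?implybT // powRr1 ?ltW.
by rewrite -powRrM -mulNr opprB.
Qed.

Lemma powRN_le (R : realType) (x y b : R) : 0 < x -> x <= y -> 0 <= b ->
  y `^ (- b) <= x `^ (- b).
Proof.
move=> x0 xy b0; have y0 := lt_le_trans x0 xy.
rewrite !powRN lef_pV2 ?posrE ?powR_gt0 //.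
by apply: ge0_ler_powR; rewrite // nnegrE ltW.
Qed.

Lemma ereal_between (R : realType) (x y : \bar R) : (x < y)%E ->
  exists d : R, (x < d%:E < y)%E.
Proof.
case: x => [x| |]; case: y => [y| |] //; rewrite ?lte_fin => xy.
- by exists ((x + y) / 2); rewrite !lte_fin; apply/andP; lra.
- by exists (x + 1); rewrite lte_fin ltry ltrDl ltr01.
- by exists (y - 1); rewrite ltNyr lte_fin gtrBl ltr01.
- by exists 0; rewrite ltNyr ltry.
Qed.

(** * Covering numbers and upper box dimension *)

Definition coverable (R : realType) (M : metricType R) (E : set M) (r c : R) :=
  exists2 s : seq M, E `<=` \bigcup_(x in [set` s]) ball x r & (size s)%:R <= c.

(** The infimum defining the covering number is over natural numbers, hence it
    is attained as soon as it is finite. *)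
Lemma covering_numberP (R : realType) (M : metricType R) (E : set M) (r c : R) :
  (covering_number E r <= c%:E)%E <-> coverable E r c.
Proof.
split=> [Nc|[s Es sc]]; last first.
  by apply: ge_ereal_inf; exists (size s)%:R%:E; [exists s|rewrite lee_fin].
have c0 : 0 <= c.
  rewrite -lee_fin; apply: le_trans Nc; apply: le_ereal_inf_tmp => _ [s _ <-].
  by rewrite lee_fin.
have /ereal_inf_lt[_ [s Es <-]] :
    (covering_number E r < (Num.truncn c).+1%:R%:E)%E.
  by apply: le_lt_trans Nc _; rewrite lte_fin truncnS_gt.
rewrite lte_fin ltr_nat ltnS => sc; exists s => //.
by rewrite (le_trans _ (_ : (Num.truncn c)%:R <= c)) ?ler_nat // truncn_le.
Qed.

Lemma coverableS (R : realType) (M : metricType R) (E F : set M) (r c : R) :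
  E `<=` F -> coverable F r c -> coverable E r c.
Proof. by move=> EF [s Fs sc]; exists s => // x /EF/Fs. Qed.

Lemma upper_box_dim_lt (R : realType) (M : metricType R) (F : set M) (d : R) :
  (upper_box_dim F < d%:E)%E ->
  exists2 rho : R, 0 < rho <= 1 &
    forall r, 0 < r < rho -> coverable F r (r `^ (- d)).
Proof.
move=> /ereal_inf_lt[_ [A A0 <-] Ad].
have [e /= e0 eA] := A0.
exists (Num.min 1 e); first by rewrite lt_min ltr01 e0 ge_min lexx.
move=> r /andP[r0]; rewrite lt_min => /andP[r1 re].
have Ar : A r by apply: eA => //=; rewrite sub0r normrN gtr0_norm.
have lnr : 0 < - ln r by rewrite oppr_gt0 ln_lt0 // r0.
have : (lne (covering_number F r) / (- ln r)%:E <= d%:E)%E.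
  by apply/ltW/(le_lt_trans _ Ad)/ereal_sup_ubound; exists r.
rewrite inver gt_eqF // lee_pdivrMr // -EFinM => lnN.
apply/covering_numberP; rewrite -lee_lne.
- by rewrite lne_EFin ?powR_gt0 // ln_powR mulNr -mulrN.
- rewrite in_itv /= leey andbT; apply: le_ereal_inf_tmp => _ [s _ <-].
  by rewrite lee_fin.
- by rewrite in_itv /= leey andbT lee_fin powR_ge0.
Qed.

(** The constant K is absorbed by an arbitrarily small increase of the
    exponent. *)
Lemma upper_box_dim_le (R : realType) (M : metricType R) (F : set M)
    (K rho d : R) :
  0 < rho -> (forall r, 0 < r <= rho -> coverable F r (K * r `^ (- d))) ->
  (upper_box_dim F <= d%:E)%E.
Proof.
move=> rho0 FK; apply/lee_addgt0Pr => e e0; rewrite -EFinD.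
have [rho1 /andP[rho10 rho11] He] : exists2 rho : R, 0 < rho <= 1 &
    forall r, 0 < r <= rho -> r `^ e <= (Num.max K 1)^-1.
  by apply: powR_small; rewrite // invr_gt0 lt_max ltr01 orbT.
apply: ge_ereal_inf.
exists (ereal_sup [set (lne (covering_number F r) / (- ln r)%:E)%E | r in
   [set r | 0 < r < Num.min rho rho1]]).
  exists [set r | 0 < r < Num.min rho rho1] => //.
  apply: filterS2 (nbhs_right_gt 0)
    (nbhs_right_lt (_ : 0 < Num.min rho rho1)) => [r /= -> -> //|].
  by rewrite lt_min rho0.
apply: ge_ereal_sup => _ [r /andP[r0 rlt] <-].
move: rlt; rewrite lt_min => /andP[rrho rrho1].
have r1 : r < 1 by exact: lt_le_trans rrho1 rho11.
have lnr : 0 < - ln r by rewrite oppr_gt0 ln_lt0 // r0.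
rewrite inver gt_eqF // lee_pdivrMr // -EFinM.
have : (covering_number F r <= (r `^ (- (d + e)))%:E)%E.
  apply/covering_numberP; have [|s Fs sK] := FK r; first by rewrite r0 ltW.
  exists s => //; apply: le_trans sK _.
  have rd : r `^ (- d) = r `^ (- (d + e)) * r `^ e.
    by rewrite -powRD ?(gt_eqF r0) ?implybT // opprD addrNK.
  rewrite rd mulrCA ger_pMr ?powR_gt0 //.
  have K0 : 0 < Num.max K 1 by rewrite lt_max ltr01 orbT.
  have /He : 0 < r <= rho1 by rewrite r0 ltW.
  rewrite -[_^-1]mul1r ler_pdivlMr //; apply: le_trans.
  by rewrite mulrC ler_wpM2l ?powR_ge0 // le_max lexx.
rewrite -lee_lne; last 2 first.
- rewrite in_itv /= leey andbT; apply: le_ereal_inf_tmp => _ [s _ <-].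
  by rewrite lee_fin.
- by rewrite in_itv /= leey andbT lee_fin powR_ge0.
by rewrite lne_EFin ?powR_gt0 // ln_powR mulNr -mulrN.
Qed.

(** * Bounds valid for general sets *)

Definition admissible (R : realType) (M : metricType R) (F : set M)
    (theta alpha : R) :=
  exists2 C : R, 0 < C & exists2 rho : R, 0 < rho &
    forall r, 0 < r <= rho -> forall x, F x ->
      coverable (ball x r `&` F) (r `^ theta^-1)
        (C * (r / r `^ theta^-1) `^ alpha).

Lemma assouad_spectrumE (R : realType) (M : metricType R) (F : set M)
    (theta : R) :
  assouad_spectrum F theta =
  ereal_inf [set alpha%:E | alpha in admissible F theta].
Proof.
rewrite /assouad_spectrum; congr ereal_inf; congr (_ @` _).
apply/seteqP; split=> alpha [C C0 [rho rho0 H]]; exists C => //;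
  by exists rho => // r rr x Fx; apply/covering_numberP/H.
Qed.

(** A nonempty set needs at least one ball, whereas for alpha < 0 the bound
    C (r / r ^ kappa) ^ alpha tends to 0 with r. *)
Lemma admissible_ge0 (R : realType) (M : metricType R) (F : set M) (x : M)
    (theta alpha : R) :
  F x -> 0 < theta < 1 -> admissible F theta alpha -> 0 <= alpha.
Proof.
move=> Fx /andP[t0 t1] [C C0 [rho rho0 cov]]; rewrite leNgt; apply/negP => a0.
have k1 : 1 < theta^-1 by rewrite invf_gt1.
have [r' /andP[r'0 r'1] small] : exists2 r' : R, 0 < r' <= 1 &
    forall r, 0 < r <= r' -> r `^ (- ((theta^-1 - 1) * alpha)) <= (2 * C)^-1.
  by apply: powR_small; rewrite ?invr_gt0 ?mulr_gt0 // -mulrN;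
    rewrite mulr_gt0 ?oppr_gt0 ?subr_gt0.
set r := Num.min rho r'.
have r0 : 0 < r by rewrite lt_min rho0.
have [|s Fs] := cov r _ x Fx; first by rewrite r0 ge_min lexx.
apply/negP; rewrite -ltNge powR_ratio //.
apply: (@lt_le_trans _ _ 1).
  have /small : 0 < r <= r' by rewrite r0 ge_min lexx orbT.
  rewrite -(ler_pM2l C0) => /le_lt_trans; apply.
  by rewrite invfM mulrCA divff ?gt_eqF // mulr1 invf_lt1 ?ltr1n.
rewrite ler1n lt0n size_eq0; apply/eqP => s0.
by have [|y] := Fs x; [split=> //; exact: ballxx|rewrite s0].
Qed.

(** With delta = r ^ (1 / theta), the exponent alpha = d / (1 - theta) is the
    one for which (r / delta) ^ alpha = delta ^ (- d); a covering of the whole of F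
    by delta ^ (- d) balls is then good enough for every ball of radius r. *)
Lemma assouad_spectrum_le_box (R : realType) (M : metricType R) (F : set M)
    (theta : R) : 0 < theta < 1 ->
  (assouad_spectrum F theta <= upper_box_dim F / (1 - theta)%:E)%E.
Proof.
move=> /andP[t0 t1]; have t1' : 0 < 1 - theta by rewrite subr_gt0.
rewrite inver gt_eqF // lee_pdivlMr //.
rewrite leNgt; apply/negP => dlt.
have [d /andP[Fd]] : exists d : R,
    (upper_box_dim F < d%:E < assouad_spectrum F theta * (1 - theta)%:E)%E.
  exact: ereal_between.
rewrite -lte_pdivrMr // => /lt_geF/negP; apply.
apply: ereal_inf_lbound; exists (d / (1 - theta)); last by rewrite EFinM.
exists 1 => //.
have [rho /andP[rho0 rho1] FN] := upper_box_dim_lt Fd.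
exists ((rho / 2) `^ theta); first by rewrite powR_gt0 // divr_gt0.
move=> r /andP[r0 rrho] x Fx; apply/covering_numberP.
rewrite mul1r powR_ratio //.
have -> : r `^ (- ((theta^-1 - 1) * (d / (1 - theta)))) =
    (r `^ theta^-1) `^ (- d).
  rewrite -powRrM mulrN; congr (_ `^ - _); field.
  by rewrite !gt_eqF.
apply: (@coverableS _ _ _ F); first exact: subIsetr.
apply: FN; rewrite powR_gt0 //=.
apply: (@le_lt_trans _ _ (rho / 2)); last by rewrite gtr_pMr //; lra.
have -> : rho / 2 = ((rho / 2) `^ theta) `^ theta^-1.
  by rewrite -powRrM divff ?gt_eqF // powRr1 // divr_ge0 // ltW.
by apply: ge0_ler_powR; rewrite ?nnegrE ?powR_ge0 ?invr_ge0 // ltW.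
Qed.

Lemma lineballE (R : realType) (x r y : R) :
  ball (x : R^o) r y = (`|x - y| < r) :> Prop.
Proof. by []. Qed.

(** An interval of radius r is covered by the balls of radius delta <= r centred
    at the points of a grid of step delta; they are at most 2 r / delta + 1. *)
Lemma assouad_spectrum_le1 (R : realType) (F : set R^o) (theta : R) :
  0 < theta < 1 -> (assouad_spectrum F theta <= 1)%E.
Proof.
move=> /andP[t0 t1]; apply: ereal_inf_lbound; exists 1 => //.
exists 3 => //; exists 1 => // r /andP[r0 r1] x _; apply/covering_numberP.
set d := r `^ theta^-1.
have d0 : 0 < d by rewrite powR_gt0.
have dr : d <= r by apply: ge1r_powR; rewrite ?r0 // invf_ge1 // ltW.
have rd1 : 1 <= r / d by rewrite ler_pdivlMr // mul1r.
rewrite powRr1 ?(le_trans ler01) //.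
exists [seq (x - r + k%:R * d : R^o) |
    k <- iota 0 (Num.truncn (2 * (r / d))).+1].
  move=> y [+ _]; rewrite lineballE ltr_distlC => /andP[ylo yhi].
  have q0 : 0 <= (y - (x - r)) / d by rewrite divr_ge0 ?(ltW d0) //; lra.
  have /andP[klo khi] := truncn_itv q0.
  set k := Num.truncn _ in klo khi.
  exists (x - r + k%:R * d).
    apply/mapP; exists k => //; rewrite mem_iota add0n ltnS le_truncn //.
    by rewrite mulrA ler_pM2r ?invr_gt0 //; lra.
  move: klo khi; rewrite ler_pdivlMr // ltr_pdivrMr // -natr1 lineballE => *.
  by rewrite ltr_distlC; apply/andP; lra.
rewrite size_map size_iota -natr1.
have : (Num.truncn (2 * (r / d)))%:R <= 2 * (r / d) by rewrite truncn_le; lra.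
lra.
Qed.

(** * Packing on the line *)

(** A lower bound on covering numbers: an open ball of radius d contains at most
    one of several points at pairwise distance at least 2 d. *)
Lemma separated_count (R : realType) (p : nat -> R) (m : nat) (s : seq R)
    (d : R) :
  (forall i j, (i < j < m)%N -> 2 * d <= `|p i - p j|) ->
  (forall i, (i < m)%N -> exists2 x, x \in s & `|x - p i| < d) ->
  (m <= size s)%N.
Proof.
move=> psep pcov.
have /choice[g gP] : forall i, exists x, (i < m)%N -> x \in s /\ `|x - p i| < d.
  move=> i; case: (boolP (i < m)%N) => [/pcov[x xs xp]|_]; first by exists x.
  by exists 0.
have sep i j : (i < j)%N -> (j < m)%N -> g i <> g j.
  move=> ij jm gij.
  have [_] := gP i (ltn_trans ij jm); have [_] := gP j jm.
  rewrite -gij => hj hi.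
  have := psep i j; rewrite ij jm => /(_ isT); apply/negP; rewrite -ltNge.
  rewrite (_ : p i - p j = (g i - p j) - (g i - p i)); last by ring.
  by apply: le_lt_trans (ler_normB _ _) _; lra.
rewrite -[m](size_iota 0) -(size_map g); apply: uniq_leq_size.
  rewrite map_inj_in_uniq ?iota_uniq // => i j; rewrite !mem_iota !add0n /=.
  move=> im jm; case: (ltngtP i j) => //.
    by move=> ij /(sep _ _ ij jm).
  by move=> ji /esym/(sep _ _ ji im).
by move=> _ /mapP[i + ->]; rewrite mem_iota add0n /= => /gP[].
Qed.

(** * Convex sequences tending to zero *)

(** Convexity is expressed by the monotonicity of the gaps.  For a monotone
    sequence of positive terms, [cn_lim] amounts to convergence to 0. *)
Record convex_null (R : realType) (a : nat -> R) : Prop := ConvexNull {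
  cn_gt0 : forall n, 0 < a n;
  cn_le1 : forall n, a n <= 1;
  cn_decr : forall m n, (m <= n)%N -> a n <= a m;
  cn_gap : forall m n, (m <= n)%N -> a n - a n.+1 <= a m - a m.+1;
  cn_lim : forall e, 0 < e -> exists n, a n <= e }.

Definition range0 (R : realType) (a : nat -> R) : set R^o :=
  [set 0] `|` range a.

(** The gaps below the n-th term are shorter than e as well, so for y > 0 the
    first term of the sequence not above y is closer to y than e. *)
Lemma convex_null_dense (R : realType) (a : nat -> R) (n : nat) (e y : R) :
  convex_null a -> a n - a n.+1 < e -> 0 <= y <= a n ->
  exists2 p, range0 a p & 0 <= p <= y /\ y - p < e.
Proof.
move=> ca gape /andP[]; rewrite le_eqVlt => /predU1P[<- _|y0 yan].
  exists 0; [by left|rewrite lexx subrr; split=> //].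
  by apply: le_lt_trans gape; rewrite subr_ge0 (cn_decr ca).
have := cn_lim ca y0; case/ex_minnP => j jy jmin.
case: (leqP j n) => [jn|nj].
  exists (a n); first by right; exists n.
  have -> : y = a n.
    by apply/eqP; rewrite eq_le yan (le_trans (cn_decr ca jn)).
  rewrite lexx (ltW (cn_gt0 ca _)) subrr; split=> //.
  by apply: le_lt_trans gape; rewrite subr_ge0 (cn_decr ca).
case: j => // j in jy jmin nj *.
exists (a j.+1); first by right; exists j.+1.
rewrite jy (ltW (cn_gt0 ca _)); split=> //.
have yj : y < a j by rewrite ltNge; apply/negP => /jmin; rewrite ltnn.
by have := cn_gap ca (nj : (n <= j)%N); lra.
Qed.

(** When the gap below a n >= r / 2 is shorter than 2 d, each of the roughly
    r / (12 d) multiples of 6 d below r / 2 has a point of the sequence within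
    2 d, hence a centre of the covering within 3 d; no centre serves twice. *)
Lemma small_gap_cover (R : realType) (a : nat -> R) (n : nat) (r d c : R) :
  convex_null a -> 0 < d -> 0 < r -> r / 2 <= a n -> a n - a n.+1 < 2 * d ->
  coverable (ball (0 : R^o) r `&` range0 a) d c -> r < 12 * d * c.
Proof.
move=> ca d0 r0 ran gapd [s Fs sc].
have q0 : 0 <= r / (12 * d) by rewrite divr_ge0 ?mulr_ge0 // ltW.
have /andP[mlo mhi] := truncn_itv q0.
set m := Num.truncn _ in mlo mhi.
have d12 : 0 < 12 * d by rewrite mulr_gt0.
move: mlo mhi; rewrite ler_pdivlMr // ltr_pdivrMr // => mlo mhi.
have ms : (m.+1 <= size s)%N.
  apply: (@separated_count _ (fun i => i%:R * (6 * d)) m.+1 s (3 * d)).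
    move=> i j /andP[ij _]; rewrite -mulrBl normrM.
    rewrite [`|6 * d|]gtr0_norm ?mulr_gt0 //.
    have : 1 <= `|i%:R - j%:R : R|.
      by rewrite distrC -natrB 1?ltnW // normr_nat ler1n subn_gt0.
    move=> ?; rewrite mulrA (_ : 2 * 3 = 6) -?natrM //.
    by rewrite ler_peMl // mulr_ge0 // ltW.
  move=> i; rewrite ltnS -(ler_nat R) => im.
  have [|p Fp [/andP[p0 py] yp]] :=
      convex_null_dense (y := i%:R * (6 * d)) ca gapd.
    apply/andP; split; first by rewrite !mulr_ge0 // ltW.
    apply: le_trans ran; apply: (@le_trans _ _ (m%:R * (6 * d))); last by lra.
    by rewrite ler_wpM2r // mulr_ge0 // ltW.
  have iy : i%:R * (6 * d) <= m%:R * (6 * d).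
    by rewrite ler_wpM2r // mulr_ge0 // ltW.
  have [|x xs] := Fs p.
    by split=> //; rewrite lineballE sub0r normrN ger0_norm //; lra.
  rewrite lineballE => xp; exists x => //.
  move: xp; rewrite !ltr_distlC => /andP[? ?]; apply/andP; lra.
apply: lt_le_trans mhi _; rewrite [12 * d * c]mulrC ler_wpM2r ?(ltW d12) //.
by apply: le_trans sc; rewrite ler_nat.
Qed.

(** The covering property that an admissible exponent alpha provides at the
    accumulation point, where k stands for 1 / theta and b for (k - 1) alpha. *)
Definition local_cover_bound (R : realType) (a : nat -> R) (k b C rho : R) :=
  forall r, 0 < r <= rho ->
    coverable (ball (0 : R^o) r `&` range0 a) (r `^ k) (C * r `^ (- b)).

(** A shorter gap would force about r / r ^ k balls by [small_gap_cover]; for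
    small r this is more than C r ^ (- b) because b < k - 1. *)
Lemma gap_ge (R : realType) (a : nat -> R) (k b C rho : R) :
  convex_null a -> 0 < C -> b < k - 1 -> 0 < rho ->
  local_cover_bound a k b C rho ->
  exists2 rho1, 0 < rho1 <= rho & forall r n, 0 < r <= rho1 -> r / 2 <= a n ->
    2 * r `^ k <= a n - a n.+1.
Proof.
move=> ca C0 bk rho0 cov.
have C12 : 0 < 12 * C by rewrite mulr_gt0.
have [rho1 /andP[rho10 _] small] : exists2 rho1 : R, 0 < rho1 <= 1 &
    forall r, 0 < r <= rho1 -> r `^ (k - 1 - b) <= (12 * C)^-1.
  by apply: powR_small; rewrite ?subr_gt0 ?invr_gt0.
exists (Num.min rho rho1); first by rewrite lt_min rho0 rho10 ge_min lexx.
move=> r n /andP[r0]; rewrite le_min => /andP[rrho rrho1] ran.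
rewrite leNgt; apply/negP => gapr.
have /cov rcov : 0 < r <= rho by rewrite r0.
have := small_gap_cover ca (powR_gt0 k r0) r0 ran gapr rcov.
have -> : 12 * r `^ k * (C * r `^ (- b)) = r * (12 * C * r `^ (k - 1 - b)).
  rewrite [k - 1 - b](_ : _ = k + - b + -1); last by ring.
  rewrite !powRD ?(gt_eqF r0) ?implybT // powR_inv1 ?(ltW r0) //.
  by field; rewrite gt_eqF.
apply/negP; rewrite -leNgt ger_pMr //.
have /small : 0 < r <= rho1 by rewrite r0.
by rewrite -[_^-1]mulr1 ler_pdivlMl.
Qed.

(** The number of terms above height r is O (r ^ (- b)).  The induction on n is
    a descent through dyadic scales: terms at height 2 a n or above are counted by
    the induction hypothesis, and those between a n and 2 a n are separated by
    [gap_ge], hence counted by the local covering bound.  Doubling the height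
    gains the factor w = 2 ^ b > 1, which pays for the new terms. *)
Lemma index_le (R : realType) (a : nat -> R) (k b C rho : R) :
  convex_null a -> 0 < C -> 0 < b < k - 1 -> 0 < rho ->
  local_cover_bound a k b C rho ->
  exists2 A, 0 < A & forall n, n.+1%:R <= A * a n `^ (- b).
Proof.
move=> ca C0 /andP[b0 bk] rho0 cov.
have [rho1 /andP[rho10 rho1rho] gap2] := gap_ge ca C0 bk rho0 cov.
have [n0 an0] := cn_lim ca (divr_gt0 rho10 (ltr0Sn _ 1)).
set w : R := 2 `^ b.
have w1 : 0 < w - 1.
  have : 1 `^ b < w by apply: gt0_ltr_powR; rewrite ?nnegrE // ltr1n.
  by rewrite powR1 subr_gt0.
(* The first summand settles the terms above the scale at which gap_ge starts;
   the second one is the fixed point of A = (A + C) / w. *)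
set A := n0.+1%:R + C / (w - 1).
have Cw : 0 < C / (w - 1) by rewrite divr_gt0.
have n0A : n0.+1%:R <= A by rewrite lerDl ltW.
have A0 : 0 < A by rewrite (lt_le_trans _ n0A).
have ACw : A + C <= A * w.
  have : C / (w - 1) <= A by rewrite lerDr.
  by rewrite ler_pdivrMr // mulrBr mulr1; lra.
exists A => //; elim/ltn_ind => n IH.
have an := cn_gt0 ca n.
case: (leqP n n0) => [nn0|/ltnW n0n].
  apply: (@le_trans _ _ A); first by rewrite (le_trans _ n0A) // ler_nat ltnS.
  rewrite ler_peMr ?(ltW A0) //.
  by have := powRN_le an (cn_le1 ca n) (ltW b0); rewrite powR1.
set r := 2 * a n.
have r0 : 0 < r by rewrite mulr_gt0.
have rrho1 : r <= rho1 by rewrite /r; have := cn_decr ca n0n; lra.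
have [|s Fs sC] := cov r; first by rewrite r0 (le_trans rrho1).
(* m counts the terms at height r or above. *)
have : exists m, a m < r by exists n; rewrite /r; lra.
case/ex_minnP => m amr mmin.
have mn : (m <= n)%N by apply: mmin; rewrite /r; lra.
have mA : m%:R <= A * r `^ (- b).
  case: m {amr mn} mmin => [|m] mmin; first by rewrite mulr_ge0 ?powR_ge0 ?ltW.
  have ram : r <= a m by rewrite leNgt; apply/negP => /mmin; rewrite ltnn.
  have mn : (m < n)%N.
    by rewrite ltnNge; apply/negP => /(cn_decr ca); rewrite /r in ram; lra.
  apply: le_trans (IH _ mn) _; rewrite ler_wpM2l ?(ltW A0) //.
  by apply: powRN_le; rewrite ?(ltW b0).
have nms : (n.+1 - m <= size s)%N.
  apply: (@separated_count _ (fun i => a (m + i)%N) _ s (r `^ k)).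
    move=> i j /andP[ij jn].
    have jn' : (m + i <= n)%N.
      by rewrite -ltnS -ltn_subRL (ltn_trans ij jn).
    apply: le_trans (ler_norm _).
    have /gap2 : 0 < r <= rho1 by rewrite r0.
    move=> /(_ (m + i)%N); rewrite /r mulrAC divff ?mul1r //.
    move=> /(_ (cn_decr ca jn')) /le_trans; apply.
    by rewrite lerD2l lerN2 (cn_decr ca) // -addnS leq_add2l.
  move=> i im; have [|x xs xb] := Fs (a (m + i)%N).
    split; last by right; exists (m + i)%N.
    rewrite lineballE sub0r normrN gtr0_norm ?(cn_gt0 ca) //.
    by apply: le_lt_trans amr; rewrite (cn_decr ca) ?leq_addr.
  by exists x.
have nsum : n.+1%:R <= (A + C) * r `^ (- b).
  have -> : n.+1%:R = m%:R + (n.+1 - m)%:R :> R by rewrite -natrD subnKC ?leqW.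
  by rewrite mulrDl lerD // (le_trans _ sC) // ler_nat.
apply: le_trans nsum _; rewrite /r powRM ?(ltW an) // [2 `^ _]powRN -/w.
by rewrite mulrA ler_pM2r ?powR_gt0 // ler_pdivrMr // powR_gt0.
Qed.

(** At scale d, the radius r with r ^ k = d splits the set: the part below r is
    handled by the local bound, the terms above r by one ball each. *)
Lemma range0_cover (R : realType) (a : nat -> R) (k b C rho : R) :
  convex_null a -> 1 < k -> 0 < C -> 0 < b < k - 1 -> 0 < rho ->
  local_cover_bound a k b C rho ->
  exists2 K, 0 < K & exists2 rho', 0 < rho' &
    forall d, 0 < d <= rho' -> coverable (range0 a) d (K * d `^ (- (b / k))).
Proof.
move=> ca k1 C0 bk rho0 cov; have k0 := lt_trans ltr01 k1.
have [A A0 aA] := index_le ca C0 bk rho0 cov; have /andP[b0 _] := bk.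
exists (C + A); first exact: addr_gt0.
exists (rho `^ k); first exact: powR_gt0.
move=> d /andP[d0 drho]; set r := d `^ k^-1.
have r0 : 0 < r by exact: powR_gt0.
have rk : r `^ k = d by rewrite -powRrM mulVf ?gt_eqF // powRr1 ?ltW.
have rb : d `^ (- (b / k)) = r `^ (- b).
  by rewrite -powRrM mulrN mulrC.
have [|s Fs sC] := cov r.
  rewrite r0 /=.
  have -> : rho = (rho `^ k) `^ k^-1.
    by rewrite -powRrM divff ?gt_eqF // powRr1 ?ltW.
  by apply: ge0_ler_powR; rewrite ?nnegrE ?powR_ge0 ?invr_ge0 // ltW.
rewrite rk in Fs; rewrite rb.
have Ar0 : 0 <= A * r `^ (- b) by rewrite mulr_ge0 ?powR_ge0 ?ltW.
exists (s ++ [seq (a i : R^o) |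
    i <- iota 0 (Num.truncn (A * r `^ (- b)))]); last first.
  by rewrite size_cat size_map size_iota natrD mulrDl lerD // truncn_le.
have near y : range0 a y -> 0 <= y < r ->
    exists2 x, x \in s & ball (x : R^o) d y.
  move=> Fy /andP[y0 yr]; have [|x xs xb] := Fs y; last by exists x.
  by split=> //; rewrite lineballE sub0r normrN ger0_norm.
move=> y Fy.
have [yr|ry] := ltP y r.
  have [|x xs xb] := near y Fy.
    rewrite yr andbT; case: Fy => [->|[n _ <-]] //.
    exact: ltW (cn_gt0 ca n).
  by exists x => //=; rewrite mem_cat xs.
case: Fy ry => [->|[n _ <-] ran]; first by rewrite leNgt r0.
exists (a n); last exact: ballxx.
rewrite /= mem_cat map_f ?orbT // mem_iota add0n /= truncn_gt_nat.
apply: le_trans (aA n) _; rewrite ler_wpM2l ?(ltW A0) //.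
by apply: powRN_le; rewrite ?(ltW b0).
Qed.

(** * The spectrum of a convex sequence *)

(** Any al strictly between alpha and 1 is admissible with a positive exponent
    b = (1 / theta - 1) al, as [range0_cover] requires; then b theta is
    (1 - theta) al. *)
Lemma upper_box_dim_range0_le (R : realType) (a : nat -> R) (theta alpha : R) :
  convex_null a -> 0 < theta < 1 -> admissible (range0 a) theta alpha ->
  alpha < 1 -> (upper_box_dim (range0 a) <= (alpha * (1 - theta))%:E)%E.
Proof.
move=> ca theta01 adm a1; have /andP[t0 t1] := theta01.
have F0 : range0 a 0 by left.
have a0 : 0 <= alpha := admissible_ge0 F0 theta01 adm.
have k1 : 1 < theta^-1 by rewrite invf_gt1.
have [C C0 [rho rho0 cov]] := adm.
suff box al : alpha < al < 1 ->
    (upper_box_dim (range0 a) <= (al * (1 - theta))%:E)%E.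
  apply/lee_addgt0Pr => e e0; rewrite -EFinD.
  set al := Num.min ((alpha + 1) / 2) (alpha + e).
  have ale : al <= alpha + e by rewrite ge_min lexx orbT.
  have ala : alpha < al by rewrite lt_min; apply/andP; lra.
  have al1 : al < 1 by rewrite gt_min; apply/orP; left; lra.
  apply: (le_trans (box al _)); first by rewrite ala.
  rewrite lee_fin; nra.
move=> /andP[aal al1].
have al0 := le_lt_trans a0 aal.
have loc : local_cover_bound a theta^-1 ((theta^-1 - 1) * al) C (Num.min 1 rho).
  move=> r /andP[r0]; rewrite le_min => /andP[r1 rrho].
  have [|s Fs sC] := cov r _ 0 F0; first by rewrite r0.
  exists s => //; apply: le_trans sC _.
  rewrite powR_ratio // ler_wpM2l ?(ltW C0) //.
  by apply: ger_powR; rewrite ?r0 // lerN2 ler_pM2l ?subr_gt0 // ltW.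
have [||K K0 [rho' rho'0 gcov]] := range0_cover ca k1 C0 _ _ loc.
- by rewrite mulr_gt0 ?subr_gt0 //= gtr_pMr ?subr_gt0.
- by rewrite lt_min ltr01.
apply: (upper_box_dim_le (K := K) rho'0) => r /gcov.
have -> // : (theta^-1 - 1) * al / theta^-1 = al * (1 - theta).
by field; rewrite gt_eqF.
Qed.

Lemma assouad_spectrum_range0 (R : realType) (a : nat -> R) (theta : R) :
  convex_null a -> 0 < theta < 1 ->
  assouad_spectrum (range0 a) theta =
  Order.min (upper_box_dim (range0 a) / (1 - theta)%:E)%E 1%E.
Proof.
move=> ca theta01; apply/eqP; rewrite eq_le le_min.
rewrite assouad_spectrum_le_box ?assouad_spectrum_le1 //=.
rewrite assouad_spectrumE; apply: le_ereal_inf_tmp => _ [alpha adm <-].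
rewrite ge_min lee_fin; case: (leP 1 alpha) => [|a1]; first by rewrite orbT.
have /andP[_ t1] := theta01; have t1' : 0 < 1 - theta by rewrite subr_gt0.
rewrite orbF inver gt_eqF // lee_pdivrMr // -EFinM.
exact: upper_box_dim_range0_le.
Qed.

Theorem theorem6p2 (R : realType) (f : R -> R)
    (f_range : forall x : R, 0 < x -> 0 <= f x <= 1)
    (f_smooth : smooth_on `]0, +oo[ f)
    (g_smooth : smooth_on `]0, +oo[ (gap f))
    (f_decr : strictly_decreasing_on `]0, +oo[ f)
    (g_decr : strictly_decreasing_on `]0, +oo[ (gap f))
    (f_lim : f x @[x --> +oo] --> 0)
    (g_lim : gap f x @[x --> +oo] --> 0)
    (theta : R) (theta01 : 0 < theta < 1) :
  assouad_spectrum (sequence_set f) theta =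
  Order.min (upper_box_dim (sequence_set f) / (1 - theta)%:E)%E 1%E.
Proof.
set a := fun n : nat => f n.+1%:R.
have -> : sequence_set f = range0 a.
  congr (_ `|` _); apply/seteqP; split=> [_ [[//|n] _ <-]|_ [n _ <-]].
    by exists n.
  by exists n.+1.
have pos n : `]0, +oo[%classic (n.+1%:R : R) by rewrite /= in_itv /= andbT.
have decr (h : R -> R) m n : strictly_decreasing_on `]0, +oo[ h ->
    (m <= n)%N -> h n.+1%:R <= h m.+1%:R.
  move=> hd; rewrite leq_eqVlt => /predU1P[->//|mn].
  by apply/ltW/hd => //; rewrite ltr_nat.
apply: assouad_spectrum_range0 => //; split.
- move=> n; apply: (@le_lt_trans _ _ (f n.+2%:R)).
    by have /andP[] := f_range n.+2%:R (ltr0Sn _ _).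
  by apply: f_decr => //; rewrite ltr_nat.
- by move=> n; have /andP[] := f_range n.+1%:R (ltr0Sn _ _).
- by move=> m n; exact: decr.
- by move=> m n mn; have := decr _ _ _ g_decr mn; rewrite /gap !natr1.
- move=> e e0.
  have /cvgrPdist_le /(_ _ e0)[M [_ Me]] := f_lim.
  exists (Num.truncn M); have := Me _ (truncnS_gt M).
  by rewrite sub0r normrN => /(le_trans (ler_norm _)).
Qed.
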